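(* Let $G$ be a group with finite presentation $\mathcal P$, and let $f:\mathbb N[\frac14]\to\mathbb N[\frac14]$ be a nondecreasing function. If $f$ is an intrinsic [respectively, extrinsic] tame filling function for $G$ over $\mathcal P$, then the function $\hat f:\mathbb N\to\mathbb N$ defined by $\hat f(n)=\lceil f(n)\rceil$ is an upper bound for the intrinsic [respectively, extrinsic] diameter filling function of $(G,\mathcal P)$.
   Context: Conventions: $\mathbb N=\{0,1,2,\ldots\}$ and $\mathbb N[\frac14]=\{n/4: n\in\mathbb N\}$. Every finite presentation $\mathcal P=\langle A\mid R\rangle$ of a group $G$ is assumed symmetric: $A$ is finite and closed under inversion, no $a\in A$ represents the identity $\epsilon$ of $G$, and $R$ is a finite subset of $A^*\setminus\{1\}$ ($1$ = empty word) closed under inversion and cyclic conjugation (relators need not be freely reduced, but the freely reduced form of each relator, if nonempty, is also in $R$). $l(w)$ is the length of $w\in A^*$; $v=_G w$ means that $v,w$ represent the same element of $G$. $X$ is the Cayley 2-complex of $\mathcal P$; its 1-skeleton is the Cayley graph of $G$ with respect to $A$, in which the directed edge $e_{g,a}$ from $g$ to $ga$ labeled $a$ and the edge $e_{ga,a^{-1}}$ have the same underlying undirected edge. $d_Y$ denotes the path metric on the 1-skeleton of a 2-complex $Y$. Van Kampen diagrams: for $w\in A^*$ with $w=_G\epsilon$, a van Kampen diagram for $w$ over $\mathcal P$ is a finite, planar, contractible combinatorial 2-complex $\Delta$ with edges directed and labeled by elements of $A$, with a basepoint vertex $*$ on the boundary $\partial\Delta$, such that $\partial\Delta$ read counterclockwise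 from $*$ is an edge path labeled $w$ and every 2-cell has boundary labeled by an element of $R$ (diagrams need not be reduced). $\pi_\Delta:\Delta\to X$ is the cellular map with $\pi_\Delta( * )=\epsilon$ mapping $n$-cells to $n$-cells and preserving edge and 2-cell boundary labels and orientations. Coarse distance: for a combinatorial 2-complex $Y$ with basepoint vertex $y$ and $p\in Y$, $\widetilde d_Y(y,p)$ is: $d_Y(y,p)$ if $p$ is a vertex; $\min\{\widetilde d_Y(y,v)\mid v\in\partial(e)\}+\frac12$ if $p$ is in the interior of an edge $e$; $\max\{\widetilde d_Y(y,q)\mid q\in\partial(\sigma)\setminus Y^{(0)}\}-\frac14$ if $p$ is in the interior of a 2-cell $\sigma$. 1-combing: for a subcomplex $Z$ of $Y^{(1)}$, a 1-combing of the pair $(Y,Z)$ at a basepoint $y_0\in Y$ is a continuous function $\Psi:Z\times[0,1]\to Y$ with (C1) $\Psi(p,0)=y_0$ and $\Psi(p,1)=p$ for all $p\in Z$; (C2) if $y_0\in Z$ then $\Psi(y_0,t)=y_0$ for all $t$; (C3) if $p\in Z^{(0)}$ then $\Psi(p,t)\in Y^{(1)}$ for all $t$. Tameness: for a 1-complex $Z'$, a continuous function $\psi:Z'\times[0,1]\to Y$ is $f$-tame, for a nondecreasing $f:\mathbb N[\frac14]\to\mathbb N[\frac14]$, if $\widetilde d_Y(y,\psi(p,s))\le f(\widetilde d_Y(y,\psi(p,t)))$ for all $p\in Z'$ and $0\le s<t\le1$, where $y$ is the basepoint of $Y$ ($*$ for a van Kampen diagram, $\epsilon$ for $X$). Tame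 filling function: a nondecreasing $f:\mathbb N[\frac14]\to\mathbb N[\frac14]$ is an intrinsic [respectively, extrinsic] tame filling function for $G$ over $\mathcal P$ if for every $w\in A^*$ with $w=_G\epsilon$ there exist a van Kampen diagram $\Delta$ for $w$ over $\mathcal P$ with basepoint $*$ and a 1-combing $\Psi:\partial\Delta\times[0,1]\to\Delta$ of $(\Delta,\partial\Delta)$ at $*$ such that $\Psi$ [respectively, $\pi_\Delta\circ\Psi$] is $f$-tame. Diameter filling function: the intrinsic [respectively, extrinsic] diameter filling function of $(G,\mathcal P)$ is the minimal nondecreasing function $h:\mathbb N\to\mathbb N$ such that for all $w\in A^*$ with $w=_G\epsilon$ there is a van Kampen diagram $\Delta$ for $w$ over $\mathcal P$ with $d_\Delta( *,v)\le h(l(w))$ [respectively, $d_X(\epsilon,\pi_\Delta(v))\le h(l(w))$] for all vertices $v$ of $\Delta$. *)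

(* Defs.v *)
From HB Require Import structures.
From mathcomp Require Import all_boot all_order all_algebra.
From mathcomp Require Import all_classical all_reals all_analysis.
Import Order.TTheory GRing.Theory Num.Theory.
Import numFieldNormedType.Exports.

Set Implicit Arguments.
Unset Strict Implicit.
Unset Printing Implicit Defensive.

Local Open Scope classical_set_scope.
Local Open Scope ring_scope.

Section Words.
Variables (A : eqType) (inv : A -> A).

Definition inv_word (w : seq A) : seq A := rev (map inv w).

Definition push (a : A) (w : seq A) : seq A :=
  if w is b :: w' then if b == inv a then w' else a :: w else [:: a].

Definition free_reduce (w : seq A) : seq A := foldr push [::] w.

(* The congruence on words whose quotient is the group < A | rels >. *)
Inductive pres_eq (rels : seq (seq A)) : seq A -> seq A -> Prop :=
| pres_refl u : pres_eq rels u u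
| pres_sym u v : pres_eq rels u v -> pres_eq rels v u
| pres_trans u v w : pres_eq rels u v -> pres_eq rels v w -> pres_eq rels u w
| pres_cancel u v a : pres_eq rels (u ++ [:: a; inv a] ++ v) (u ++ v)
| pres_rel u v r : r \in rels -> pres_eq rels (u ++ r ++ v) (u ++ v).
End Words.

Definition eval (G : groupType) (A : Type) (gen : A -> G) (w : seq A) : G :=
  foldr (fun a g => (gen a * g)%g) 1%g w.

(* The alphabet carries an involution [linv]; a letter may be its own inverse
   (it then stands for an element of order 2 of G), so that both formal
   alphabets and inverse-closed subsets of G are covered. *)
Record presentation (G : groupType) := Presentation {
  letter : finType;
  linv : letter -> letter;
  relators : seq (seq letter);
  gen : letter -> G;
  linvK : involutive linv;
  relators_nnil : [::] \notin relators;
  relators_inv : forall r, r \in relators -> inv_word linv r \in relators;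
  relators_rot : forall r n, r \in relators -> rot n r \in relators;
  relators_red : forall r, r \in relators ->
    free_reduce linv r != [::] -> free_reduce linv r \in relators;
  gen_surj : forall g, exists w, eval gen w = g;
  gen_pres : forall v w, eval gen v = eval gen w <-> pres_eq linv relators v w;
  gen_neq1 : forall a, gen a != 1%g }.

Section PresentationFacts.
Variables (G : groupType) (P : presentation G).

Lemma gen_linv (a : letter P) : gen (linv a) = (gen a)^-1%g.
Proof.
have /(gen_pres (p := P)) /= := pres_cancel (@linv G P) (relators P) [::] [::] a.
by rewrite mulg1 => /(canRL (mulKg (gen a))); rewrite mulg1.
Qed.

Lemma eval_relator r : r \in relators P -> eval (@gen G P) r = 1%g.
Proof.
move=> rP; have /(gen_pres (p := P)) := pres_rel (@linv G P) [::] [::] rP.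
by rewrite /= cats0.
Qed.
End PresentationFacts.

Section Walk.
Variables (V D : eqType) (src : D -> V) (flip : D -> D).
Fixpoint walk_spec (v : V) (p : seq D) (u : V) : bool :=
  if p is d :: q then (src d == v) && walk_spec (src (flip d)) q u else v == u.
End Walk.

(* Each undirected edge is a pair {d, flip d} of distinct darts (directed edges);
   the 2-cell [f] is attached along the closed edge path [bd f]. *)
Record complex2 := Complex2 {
  vert : choiceType;
  dart : choiceType;
  face : choiceType;
  src : dart -> vert;
  flip : dart -> dart;
  corner : face -> vert;
  bd : face -> seq dart;
  flipK : involutive flip;
  flip_neq : forall d, flip d != d;
  bd_nnil : forall f, bd f != [::];
  bd_closed : forall f, walk_spec src flip (corner f) (bd f) (corner f) }.

Section Combinatorics.
Variable Y : complex2.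

Definition tgt (d : dart Y) : vert Y := src (flip d).

Definition walk (v : vert Y) (p : seq (dart Y)) (u : vert Y) : bool :=
  walk_spec (@src Y) (@flip Y) v p u.

(* The path metric on vertices; 0 if u and v lie in different components. *)
Definition dist (u v : vert Y) : nat :=
  match pselect (exists n, `[< exists2 p, walk u p v & size p = n >]) with
  | left ex => ex_minn ex
  | right _ => 0%N
  end.

Definition orient (d : dart Y) : dart Y := choose (pred2 d (flip d)) d.

Lemma orientP (d : dart Y) : orient d = d \/ orient d = flip d.
Proof.
have : pred2 d (flip d) (orient d) by apply: chooseP; rewrite /= eqxx.
by case/orP=> /eqP; [left|right].
Qed.

Lemma orient_flip (d : dart Y) : orient (flip d) = orient d.
Proof.
rewrite /orient (@eq_choose _ _ (pred2 d (flip d))) => [|e]; last first.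
  by rewrite /= flipK orbC.
by apply: choose_id; rewrite /= eqxx ?orbT.
Qed.

Lemma orient_flipP (d : dart Y) :
  ~ (orient d == d) -> orient (flip d) == flip d.
Proof. by rewrite orient_flip; case: (orientP d) => -> //; rewrite eqxx. Qed.
End Combinatorics.

Record cmap (Y Y' : complex2) := CMap {
  on_vert : vert Y -> vert Y';
  on_dart : dart Y -> dart Y';
  on_face : face Y -> face Y';
  cmap_src : forall d, src (on_dart d) = on_vert (src d);
  cmap_flip : forall d, on_dart (flip d) = flip (on_dart d);
  cmap_bd : forall f, bd (on_face f) = map on_dart (bd f) }.

Section Plane.
Variable R : realType.
Definition sqnorm (z : R * R) : R := z.1 ^+ 2 + z.2 ^+ 2.
Definition polar (r t : R) : R * R :=
  (r * cos (2 * pi * t), r * sin (2 * pi * t)).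

(* The retraction of the line onto [0, 1]. *)
Definition clamp (s : R) : R := Num.max 0 (Num.min 1 s).

Lemma polar_lt1 r t : clamp r < 1 -> sqnorm (polar (clamp r) t) < 1.
Proof.
move=> r1; rewrite /sqnorm /= !exprMn -mulrDr cos2Dsin2 mulr1.
by rewrite expr_lt1// /clamp le_max lexx.
Qed.

Lemma interior_flip (s : R) : 0 < s < 1 -> 0 < 1 - s < 1.
Proof. by move=> /andP[s0 s1]; rewrite subr_gt0 s1 ltrBlDr ltrDl s0. Qed.
End Plane.

(* The open edge {d, flip d} is parametrized by the chosen dart [orient d]. *)
Inductive realization (R : realType) (Y : complex2) :=
| Vpt (v : vert Y)
| Ept (d : dart Y) (s : R) of orient d == d & 0 < s < 1
| Fpt (f : face Y) (z : R * R) of sqnorm z < 1.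
Arguments Vpt {R Y}.
Arguments Ept {R Y}.
Arguments Fpt {R Y}.

Section Characteristic.
Variables (R : realType) (Y : complex2).
Notation realization := (realization R Y).

Definition open_dart_pt (d : dart Y) (s : R) (hs : 0 < s < 1) : realization :=
  match pselect (orient d == d) with
  | left hd => Ept d s hd hs
  | right hd => Ept (flip d) (1 - s) (orient_flipP hd) (interior_flip hs)
  end.

(* Characteristic map of the directed edge [d], precomposed with the retraction
   of the line onto [0, 1]. *)
Definition dart_pt (d : dart Y) (s : R) : realization :=
  match pselect (0 < s < 1) with
  | left hs => open_dart_pt d hs
  | right _ => if s <= 0 then Vpt (src d) else Vpt (tgt d)
  end.

(* The edge path [p] from [v], parametrized by [0, 1] at constant speed. *)
Definition walk_pt (v : vert Y) (p : seq (dart Y)) (t : R) : realization :=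
  if p is d :: _ then
    let i := minn (Num.truncn ((size p)%:R * t)) (size p).-1 in
    dart_pt (nth d p i) ((size p)%:R * t - i%:R)
  else Vpt v.

(* Characteristic map of the 2-cell [f] in polar coordinates (r, t), with
   angle 2 * pi * t, precomposed with the retraction of the plane onto
   [0, 1] x [0, 1]. *)
Definition face_pt (f : face Y) (rt : R * R) : realization :=
  match pselect (clamp rt.1 < 1) with
  | left h => Fpt f (polar (clamp rt.1) (clamp rt.2)) (polar_lt1 _ h)
  | right _ => walk_pt (corner f) (bd f) (clamp rt.2)
  end.

(* Weak topology of the cell complex: final for the characteristic maps. *)
Definition cw_open : set_system realization := [set U |
  (forall d, open (dart_pt d @^-1` U)) /\
  (forall f, open (face_pt f @^-1` U))].

Lemma cw_openT : cw_open setT.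
Proof. by split=> ?; rewrite preimage_setT; exact: openT. Qed.

Lemma cw_openI : setI_closed cw_open.
Proof.
by move=> U V [dU fU] [dV fV]; split=> x; rewrite preimage_setI; exact: openI.
Qed.

Lemma cw_open_bigU (I : Type) (U : I -> set realization) :
  (forall i, cw_open (U i)) -> cw_open (\bigcup_i U i).
Proof.
move=> oU; split=> x; rewrite preimage_bigcup; apply: bigcup_open => i _.
  exact: (oU i).1.
exact: (oU i).2.
Qed.
End Characteristic.

HB.instance Definition _ (R : realType) (Y : complex2) :=
  gen_eqMixin (realization R Y).
HB.instance Definition _ (R : realType) (Y : complex2) :=
  gen_choiceMixin (realization R Y).
HB.instance Definition _ (R : realType) (Y : complex2) :=
  isOpenTopological.Build (realization R Y)
    (@cw_openT R Y) (@cw_openI R Y) (@cw_open_bigU R Y).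

Section Skeleta.
Variables (R : realType) (Y : complex2).
Definition skel0 : set (realization R Y) := range Vpt.
Definition skel1 : set (realization R Y) :=
  [set p | if p is Fpt _ _ _ then False else True].
End Skeleta.

Definition realize (R : realType) (Y Y' : complex2) (phi : cmap Y Y')
    (p : realization R Y) : realization R Y' :=
  match p with
  | Vpt v => Vpt (on_vert phi v)
  | Ept d s _ _ => dart_pt (on_dart phi d) s
  | Fpt f z hz => Fpt (on_face phi f) z hz
  end.

(* The rationals n / 4 with n a natural number. *)
Definition quarter : {pred rat} := [pred x : rat | x * 4 \is a Num.nat].

Section Coarse.
Variables (R : realType) (Y : complex2) (y : vert Y).

Definition coarse_edge (d : dart Y) : rat :=
  Num.min (dist y (src d))%:R (dist y (tgt d))%:R + 2^-1.

(* In the last case all terms are positive and [bd f] is nonempty, so 0 is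
   neutral for the maximum. *)
Definition coarse_dist (p : realization R Y) : rat :=
  match p with
  | Vpt v => (dist y v)%:R
  | Ept d _ _ _ => coarse_edge d
  | Fpt f _ _ => \big[Num.max/0]_(d <- bd f) coarse_edge d - 4^-1
  end.

Definition tame (Z : Type) (D : set Z) (psi : Z * R -> realization R Y)
    (f : rat -> rat) : Prop :=
  forall p, D p -> forall s t : R, 0 <= s -> s < t -> t <= 1 ->
    coarse_dist (psi (p, s)) <= f (coarse_dist (psi (p, t))).
End Coarse.

(* 1-combings of (Y, Z) at y0; only the values of [Psi] on Z x [0, 1] matter. *)
Record combing1 (R : realType) (Y : complex2) (Z : set (realization R Y))
    (y0 : realization R Y) (Psi : realization R Y * R -> realization R Y)
    : Prop := Combing1 {
  combing_cont : {within Z `*` `[0, 1], continuous Psi};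
  combing_start : forall p, Z p -> Psi (p, 0) = y0;
  combing_end : forall p, Z p -> Psi (p, 1) = p;
  combing_base : Z y0 -> forall t, 0 <= t <= 1 -> Psi (y0, t) = y0;
  combing_vert : forall p, Z p -> skel0 p ->
    forall t, 0 <= t <= 1 -> skel1 (Psi (p, t)) }.

Section Topology.
Definition frontier (T : topologicalType) (S : set T) : set T :=
  closure S `&` closure (~` S).

Definition contractible (R : realType) (T : topologicalType) : Prop :=
  exists x0 : T, exists H : T * R -> T,
    {within [set: T] `*` `[0, 1], continuous H} /\
    forall x, H (x, 0) = x /\ H (x, 1) = x0.

Definition homeomorphism_on (T U : topologicalType) (A : set T) (B : set U)
    (f : T -> U) : Prop :=
  {within A, continuous f} /\ exists g : U -> T,
  [/\ {within B, continuous g}, set_fun A B f, set_fun B A g,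
      forall x, A x -> g (f x) = x & forall y, B y -> f (g y) = y].

(* The closed curve c on [0, 1] has winding number +1 around z. *)
Definition turns_once_ccw (R : realType) (c : R -> R * R) (z : R * R) : Prop :=
  exists rho theta : R -> R,
  [/\ {within `[0, 1], continuous theta},
      theta 1 = theta 0 + 2 * pi
    & forall t, 0 <= t <= 1 -> 0 < rho t /\
        c t = (z.1 + rho t * cos (theta t), z.2 + rho t * sin (theta t))].
End Topology.

Section Boundary.
Variables (R : realType) (Y : complex2) (emb : realization R Y -> R * R).

Definition boundary : set (realization R Y) := emb @^-1` frontier (range emb).

(* [p] is the boundary circuit of the embedded complex, read counterclockwise
   from [v]: the attaching path of the complementary 2-cell of Y in the sphere.
   That 2-cell is parametrized by [Phi] on the exterior of the unit disk (the
   centre of the cell being the point at infinity): [Phi] is a homeomorphism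
   from the open exterior onto the complement of Y and runs along [p] on the
   unit circle. The orientation is read off on the circle of radius 2, whose
   image surrounds Y. *)
Definition boundary_circuit (v : vert Y) (p : seq (dart Y)) : Prop :=
  [/\ walk v p v,
      walk_pt v p @` `[0, 1] = boundary
    & exists Phi : R * R -> R * R,
      [/\ {within [set z | 1 <= sqnorm z], continuous Phi},
          homeomorphism_on [set z | 1 < sqnorm z] (~` range emb) Phi,
          forall t, 0 <= t <= 1 -> Phi (polar 1 t) = emb (walk_pt v p t)
        & turns_once_ccw (fun t => Phi (polar 2 t)) (emb (Vpt v))]].
End Boundary.

Record vk_diagram (R : realType) (G : groupType) (P : presentation G)
    (w : seq (letter P)) := VKDiagram {
  cpx :> complex2;
  base : vert cpx;
  lab : dart cpx -> letter P;
  emb : realization R cpx -> R * R;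
  circuit : seq (dart cpx);
  vk_finite : [/\ finite_set [set: vert cpx], finite_set [set: dart cpx]
                & finite_set [set: face cpx]];
  vk_emb_cont : continuous emb;
  vk_emb_inj : injective emb;
  vk_contractible : contractible R (realization R cpx);
  vk_lab_flip : forall d, lab (flip d) = linv (lab d);
  vk_lab_face : forall f, map lab (bd f) \in relators P;
  vk_circuit : boundary_circuit emb base circuit;
  vk_lab_circuit : map lab circuit = w }.

Section Cayley.
Variables (G : groupType) (P : presentation G).

Definition cay_src (e : G * letter P) : G := e.1.
Definition cay_flip (e : G * letter P) : G * letter P :=
  ((e.1 * gen e.2)%g, linv e.2).

Fixpoint cay_path (g : G) (w : seq (letter P)) : seq (G * letter P) :=
  if w is a :: w' then (g, a) :: cay_path (g * gen a)%g w' else [::].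

(* One 2-cell at each vertex for each relator, attached along the path that
   starts at this vertex and is labelled by this relator. *)
Definition cay_face := (G * {r : seq (letter P) | r \in relators P})%type.
Definition cay_bd (f : cay_face) : seq (G * letter P) :=
  cay_path f.1 (val f.2).

Lemma cay_flipK : involutive cay_flip.
Proof. by case=> g a; rewrite /cay_flip /= gen_linv mulgK linvK. Qed.

Lemma cay_flip_neq e : cay_flip e != e.
Proof.
case: e => g a; apply/negP => /eqP[+ _] => /(canRL (mulKg g)).
by rewrite mulVg => /eqP; apply/negP; exact: gen_neq1.
Qed.

Lemma cay_bd_nnil f : cay_bd f != [::].
Proof.
case: f => g [[|a r] /= hr]; last by [].
by move: (relators_nnil P); rewrite hr.
Qed.

Lemma cay_path_walk g w :
  walk_spec cay_src cay_flip g (cay_path g w) (g * eval (@gen G P) w)%g.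
Proof.
elim: w g => [|a w IH] g /=; first by rewrite mulg1.
by rewrite eqxx /= mulgA; exact: IH.
Qed.

Lemma cay_bd_closed f : walk_spec cay_src cay_flip f.1 (cay_bd f) f.1.
Proof.
have := cay_path_walk f.1 (val f.2).
by rewrite (eval_relator (valP f.2)) mulg1.
Qed.

Definition cayley : complex2 :=
  Complex2 cay_flipK cay_flip_neq cay_bd_nnil cay_bd_closed.

Definition cay_lab (e : dart cayley) : letter P := e.2.

(* By connectedness of the diagram at most one [phi] satisfies this, namely the
   canonical map of the diagram to the Cayley 2-complex; base points and
   orientations of 2-cell boundaries are preserved by [cmap_bd]. *)
Definition is_projection (R : realType) (w : seq (letter P))
    (Delta : vk_diagram R w) (phi : cmap Delta cayley) : Prop :=
  on_vert phi (base Delta) = (1%g : G) /\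
  forall d, cay_lab (on_dart phi d) = lab d.
End Cayley.

Section Filling.
Variables (R : realType) (G : groupType) (P : presentation G).

Definition intrinsic_tame_filling (f : rat -> rat) : Prop :=
  forall w : seq (letter P), eval (@gen G P) w = 1%g ->
  exists (Delta : vk_diagram R w)
         (Psi : realization R Delta * R -> realization R Delta),
    combing1 (boundary (@emb _ _ _ _ Delta)) (Vpt (base Delta)) Psi /\
    tame (base Delta) (boundary (@emb _ _ _ _ Delta)) Psi f.

Definition extrinsic_tame_filling (f : rat -> rat) : Prop :=
  forall w : seq (letter P), eval (@gen G P) w = 1%g ->
  exists (Delta : vk_diagram R w) (phi : cmap Delta (cayley P))
         (Psi : realization R Delta * R -> realization R Delta),
    [/\ is_projection phi,
        combing1 (boundary (@emb _ _ _ _ Delta)) (Vpt (base Delta)) Psi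
      & tame (1%g : vert (cayley P)) (boundary (@emb _ _ _ _ Delta))
             (realize phi \o Psi) f].

Definition intrinsic_diam_bound (h : nat -> nat) : Prop :=
  forall w : seq (letter P), eval (@gen G P) w = 1%g ->
  exists Delta : vk_diagram R w,
    forall v : vert Delta, (dist (base Delta) v <= h (size w))%N.

Definition extrinsic_diam_bound (h : nat -> nat) : Prop :=
  forall w : seq (letter P), eval (@gen G P) w = 1%g ->
  exists (Delta : vk_diagram R w) (phi : cmap Delta (cayley P)),
    is_projection phi /\
    forall v : vert Delta,
      (dist (1%g : vert (cayley P)) (on_vert phi v) <= h (size w))%N.

Definition least_nondecreasing (Q : (nat -> nat) -> Prop) (h : nat -> nat) :=
  [/\ {homo h : m n / (m <= n)%N}, Q h
    & forall h', {homo h' : m n / (m <= n)%N} -> Q h' ->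
        forall n, (h n <= h' n)%N].

Definition intrinsic_diam_filling (h : nat -> nat) : Prop :=
  least_nondecreasing intrinsic_diam_bound h.

Definition extrinsic_diam_filling (h : nat -> nat) : Prop :=
  least_nondecreasing extrinsic_diam_bound h.
End Filling.

Definition hat (f : rat -> rat) (n : nat) : nat := `|Num.ceil (f n%:R)|%N.

(* Main.v *)
Require Import Defs.
From mathcomp Require Import all_boot all_order all_algebra.
From mathcomp Require Import all_classical all_reals all_analysis.
From mathcomp Require Import ring lra zify.
Import Order.TTheory GRing.Theory Num.Theory.
Import numFieldNormedType.Exports.

(** A tame combing bounds the distance to the base point along each combing path by
    [f] of the coarse distance of the end point of the path, and a boundary point of
    a diagram for [w] has coarse distance at most the length of [w]
    ([height_walk_le]). So the bound follows once the combing paths of the boundary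
    points are known to sweep out every vertex of the diagram.

    This is a fact of plane topology ([combing_surjective]). A combing contracts the
    boundary loop of the diagram inside the diagram; if it missed a point [q], the
    boundary loop would have winding number 0 around [q], while the boundary circuit
    of a planar contractible diagram winds once around each point of the diagram
    off the circuit. The winding numbers of two loops avoiding a point are compared
    through the relative angle of the loops ([same_turns]), which is invariant under
    homotopy ([homotopy_same_turns]) and separates a loop turning once from a
    constant loop ([turns_once_not_cst]).

    One point needs care: a boundary vertex [v] may be reached only at time 1, when
    tameness says nothing about [v] itself. There the combing path approaches [v]
    through points of coarse distance greater than that of [v] minus 1
    ([open_height_gt]), and rounding up absorbs the difference
    ([tame_height_bound]).

    Coarse distances in the diagram and in the Cayley complex are both instances of
    [height] for a vertex function changing by at most 1 along each edge, so one
    argument serves the intrinsic and the extrinsic statements. The diameter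
    filling function exists as the pointwise minimum of the nondecreasing bounds,
    one of which is [hat f] ([least_nondecreasing_exists]). *)

Local Open Scope classical_set_scope.
Local Open Scope ring_scope.

(** * Clamping and composition of continuous maps *)

Section Clamp.
Context {R : realType}.

Lemma clamp_itv (s : R) : 0 <= clamp s <= 1.
Proof. by rewrite /clamp le_max lexx ge_max ler01 ge_min lexx. Qed.

Lemma clamp_id (s : R) : 0 <= s <= 1 -> clamp s = s.
Proof. by move=> /andP[s0 s1]; rewrite /clamp min_r// max_r. Qed.

Lemma clampK (s : R) : clamp (clamp s) = clamp s.
Proof. exact/clamp_id/clamp_itv. Qed.

Lemma clamp0 : clamp (0 : R) = 0.
Proof. by rewrite clamp_id// lexx ler01. Qed.

Lemma clamp1 : clamp (1 : R) = 1.
Proof. by rewrite clamp_id// lexx ler01. Qed.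

Lemma continuous_clamp : continuous (@clamp R).
Proof.
move=> x; apply: (@continuous_max R R (cst 0) (fun s => Num.min 1 s)).
  exact: cvg_cst.
by apply: (@continuous_min R R (cst 1) id); [exact: cvg_cst|exact: cvg_id].
Qed.
End Clamp.

(** Every map that is continuous only on a part of its source is used below after
    a global map landing in that part (usually through [clamp]), so that
    continuity on subspaces never has to be handled afterwards. *)
Lemma within_comp_continuous {T U V : topologicalType} {A : set U}
    {f : U -> V} {g : T -> U} :
  {within A, continuous f} -> continuous g -> (forall x, A (g x)) ->
  continuous (f \o g).
Proof.
move=> /subspace_continuousP cf cg Ag x B /= fB.
have /= := cf _ (Ag x) B fB; rewrite nbhs_simpl /= /within /= => W.
have := cg x _ W; rewrite /= !nbhs_simpl /=.
by apply: filterS => y /=; apply; exact: Ag.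
Qed.

Lemma continuous_pair {T U V : topologicalType} {f : T -> U} {g : T -> V} :
  continuous f -> continuous g -> continuous (fun x => (f x, g x)).
Proof.
by move=> cf cg x; apply: (@cvg_pair _ _ _ _ (nbhs (f x)) (nbhs (g x)) _ _ _ f g);
  [exact: cf|exact: cg].
Qed.

Lemma continuous_comp2 {T U V W : topologicalType} {h : U * V -> W}
    {f : T -> U} {g : T -> V} :
  continuous h -> continuous f -> continuous g ->
  continuous (fun x => h (f x, g x)).
Proof.
move=> ch cf cg x; apply: (@continuous_comp _ _ _ (fun y => (f y, g y)) h).
  exact: continuous_pair.
exact: ch.
Qed.

(** * Winding of loops in the punctured plane *)

Section Turning.
Context {R : realType}.

Definition dot (z w : R * R) : R := z.1 * w.1 + z.2 * w.2.
Definition cross (z w : R * R) : R := z.1 * w.2 - z.2 * w.1.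

Lemma cvg_dot {T : Type} {F : set_system T} {FF : Filter F} {u v : T -> R * R}
    {z w : R * R} : u x @[x --> F] --> z -> v x @[x --> F] --> w ->
  dot (u x) (v x) @[x --> F] --> dot z w.
Proof.
move=> uz vw.
have u1 : (u x).1 @[x --> F] --> z.1 by apply: cvg_comp uz cvg_fst.
have u2 : (u x).2 @[x --> F] --> z.2 by apply: cvg_comp uz cvg_snd.
have v1 : (v x).1 @[x --> F] --> w.1 by apply: cvg_comp vw cvg_fst.
have v2 : (v x).2 @[x --> F] --> w.2 by apply: cvg_comp vw cvg_snd.
apply: cvgD; [exact: (cvgM u1 v1)|exact: (cvgM u2 v2)].
Qed.

Lemma cvg_cross {T : Type} {F : set_system T} {FF : Filter F} {u v : T -> R * R}
    {z w : R * R} : u x @[x --> F] --> z -> v x @[x --> F] --> w ->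
  cross (u x) (v x) @[x --> F] --> cross z w.
Proof.
move=> uz vw.
have u1 : (u x).1 @[x --> F] --> z.1 by apply: cvg_comp uz cvg_fst.
have u2 : (u x).2 @[x --> F] --> z.2 by apply: cvg_comp uz cvg_snd.
have v1 : (v x).1 @[x --> F] --> w.1 by apply: cvg_comp vw cvg_fst.
have v2 : (v x).2 @[x --> F] --> w.2 by apply: cvg_comp vw cvg_snd.
apply: cvgB; [exact: (cvgM u1 v2)|exact: (cvgM u2 v1)].
Qed.

(** In complex notation, [c' = rho * exp (i theta) * c] with [theta] returning to
    its initial value: two loops avoiding 0 are so related exactly when they have
    the same winding number. Comparing two loops, instead of defining the winding
    number of one, avoids lifting a loop to an angle: a relative angle is
    only ever needed between loops that are close to each other. *)
Definition same_turns (c c' : R -> R * R) := exists rho theta : R -> R,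
  [/\ continuous theta, theta 1 = theta 0 & forall t, 0 < rho t /\
    c' t = (rho t * (cos (theta t) * (c t).1 - sin (theta t) * (c t).2),
            rho t * (sin (theta t) * (c t).1 + cos (theta t) * (c t).2))].

Lemma same_turns_sym {c c' : R -> R * R} : same_turns c c' -> same_turns c' c.
Proof.
move=> [rho [theta [cth th01 H]]]; exists (fun t => (rho t)^-1).
exists (fun t => - theta t); split=> [t||t]; last 1 first.
- have [r0 ->] := H t; split; first by rewrite invr_gt0.
  rewrite cosN sinN /= [LHS]surjective_pairing; have := cos2Dsin2 (theta t).
  move=> E; congr pair; first rewrite -[LHS]mul1r -E; last rewrite -[LHS]mul1r -E.
    by field; rewrite gt_eqF.
  by field; rewrite gt_eqF.
- by apply: cvgN; exact: cth.
- by rewrite th01.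
Qed.

Lemma same_turns_trans {c c' c'' : R -> R * R} :
  same_turns c c' -> same_turns c' c'' -> same_turns c c''.
Proof.
move=> [rho [theta [cth th01 H]]] [rho' [theta' [cth' th01' H']]].
exists (fun t => rho' t * rho t); exists (fun t => theta' t + theta t); split.
- by move=> t; apply: cvgD; [exact: cth'|exact: cth].
- by rewrite th01 th01'.
- move=> t; have [r0 E] := H t; have [r0' ->] := H' t.
  split; first exact: mulr_gt0.
  by rewrite E /= cosD sinD; congr pair; ring.
Qed.

(** A positive scalar product says that [c' / c] stays in the right half-plane,
    where [atan] is a continuous branch of the argument. *)
Lemma same_turns_dot {c c' : R -> R * R} : continuous c -> continuous c' ->
  c 0 = c 1 -> c' 0 = c' 1 -> (forall t, 0 < dot (c t) (c' t)) ->
  same_turns c c'.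
Proof.
move=> cc cc' c01 c01' H.
pose theta t := atan (cross (c t) (c' t) / dot (c t) (c' t)).
exists (fun t => dot (c t) (c' t) / (sqnorm (c t) * cos (theta t))).
exists theta; split=> [t||t]; last 1 first.
- have D0 := H t; set th := theta t.
  have C0 : 0 < cos th.
    by apply: cos_gt0_pihalf; rewrite /th/theta atan_gtNpi2 atan_ltpi2.
  have S0 : 0 < sqnorm (c t).
    rewrite lt_neqAle addr_ge0 ?sqr_ge0// andbT eq_sym paddr_eq0 ?sqr_ge0//.
    rewrite !sqrf_eq0; apply/negP => /andP[/eqP a /eqP b].
    by move: D0; rewrite /dot a b !mul0r addr0 ltxx.
  split; first by rewrite divr_gt0// mulr_gt0.
  have T : sin th = cos th * (cross (c t) (c' t) / dot (c t) (c' t)).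
    by rewrite -[X in cos th * X]atanK -/(theta t) -/th /tan mulrC divfK// gt_eqF.
  rewrite T [LHS]surjective_pairing.
  move: D0 S0; rewrite /dot /cross /sqnorm => D0 S0.
  by congr pair; field; rewrite !gt_eqF.
- apply: continuous_comp; last exact: continuous_atan.
  apply: cvgM; first exact: cvg_cross (cc t) (cc' t).
  by apply: cvgV; [rewrite gt_eqF|exact: cvg_dot (cc t) (cc' t)].
- by rewrite /theta c01 c01'.
Qed.

(** By compactness of [0, 1], loops of the family with close parameters have a
    positive scalar product at all times, so the classes of [same_turns] along the
    family are open in the parameter. Each class is then also closed, and the line
    is connected. *)
Lemma homotopy_same_turns {H : R * R -> R * R} :
  continuous H -> (forall ts, H ts != 0) -> (forall s, H (0, s) = H (1, s)) ->
  forall s s', same_turns (fun t => H (clamp t, s)) (fun t => H (clamp t, s')).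
Proof.
move=> cH H0 H01 s; pose c s := fun t => H (clamp t, s).
have cc s1 : continuous (c s1).
  apply: continuous_comp2 => //; first exact: continuous_clamp.
  by move=> t; exact: cvg_cst.
have c01 s1 : c s1 0 = c s1 1 by rewrite /c clamp0 clamp1.
have loc (s0 : R) : \forall s1 \near s0, same_turns (c s0) (c s1).
  have NC : near_covering `[(0 : R), 1].
    by apply/compact_near_coveringP; exact: segment_compact.
  have pos (t : R) : \forall t' \near t & s1 \near s0,
      0 < dot (H (t', s0)) (H (t', s1)).
    have : (fun x : R * R => dot (H (x.1, s0)) (H (x.1, x.2))) x @[x --> (t, s0)]
        --> dot (H (t, s0)) (H (t, s0)).
      have cst_s0 : continuous (fun _ : R * R => s0) by move=> ?; exact: cvg_cst.
      have c1 : continuous (@fst R R) by move=> ?; exact: cvg_fst.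
      have c2 : continuous (@snd R R) by move=> ?; exact: cvg_snd.
      have h0 := continuous_comp2 cH c1 cst_s0 (t, s0).
      have h1 := continuous_comp2 cH c1 c2 (t, s0).
      exact: cvg_dot h0 h1.
    have P : 0 < dot (H (t, s0)) (H (t, s0)).
      have := H0 (t, s0); case: (H _) => a b /= ab.
      rewrite /dot /= -!expr2 lt_neqAle addr_ge0 ?sqr_ge0// andbT eq_sym.
      rewrite paddr_eq0 ?sqr_ge0// !sqrf_eq0; apply: contra ab.
      by move=> /andP[/eqP -> /eqP ->].
    by move=> /(_ _ (open_nbhs_nbhs (conj (@open_gt R 0) P))).
  have N : \forall s1 \near s0, `[0, 1] `<=`
      (fun t => 0 < dot (H (t, s0)) (H (t, s1))).
    exact: (NC R (nbhs s0) (fun s1 t => 0 < dot (H (t, s0)) (H (t, s1)))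
      (nbhs_filter s0) (fun t _ => pos t)).
  apply: filterS N => s1 /= Q; apply: same_turns_dot => // t.
  by apply: Q; rewrite /= in_itv/= clamp_itv.
(* The class of the loop of parameter [s]. *)
pose A : set R := [set s1 | same_turns (c s) (c s1)].
have locA (s0 : R) : \forall s1 \near s0, A s1 <-> A s0.
  apply: filterS (loc s0) => s1 L; split=> K; apply: (same_turns_trans K) => //.
  exact: same_turns_sym.
have openA : open A.
  by rewrite openE => x Ax; apply: filterS (locA x) => y [_]; apply.
have closedA : closed A.
  rewrite -[A]setCK; apply: open_closedC; rewrite openE => x nAx.
  by apply: filterS (locA x) => y [h _] /h.
have conn : connected [set: R] by apply/connected_intervalP.
have AT : A = setT.
  apply: conn; [|by exists A; rewrite ?setTI..].
  exists s; exists (cst 1), (cst 0); split=> // t; first exact: cvg_cst.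
  split; first exact: ltr01.
  by rewrite cos0 sin0 !mul1r !mul0r subr0 add0r -surjective_pairing.
by move=> s'; have : A s' by rewrite AT.
Qed.

(** An angle of [c] around [z] minus the angle of [c] relative to the constant [w]
    is an angle of [w] itself. It grows by 2 pi in total, so it takes at some time
    the value opposite to the initial one, whereas the direction of [w] is fixed. *)
Lemma turns_once_not_cst {c : R -> R * R} {z w : R * R} :
  turns_once_ccw c z -> w != 0 ->
  ~ same_turns (cst w) (fun t => c (clamp t) - z).
Proof.
move=> [rho [theta [cth th01 H]]] w0 [rho' [theta' [cth' th01' H']]].
pose g t := theta (clamp t) - theta' t.
have cg : continuous g.
  move=> t; apply: cvgB; last exact: cth'.
  apply: (within_comp_continuous cth) => [|x].
    exact: continuous_clamp.
  by rewrite /= in_itv /= clamp_itv.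
have g1 : g 1 = g 0 + 2 * pi by rewrite /g clamp1 clamp0 th01 th01'; ring.
have p0 := pi_gt0 R.
have [t _ gt] : exists2 t, t \in `[0, 1] & g t = g 0 + pi.
  apply: IVT => //; first exact: continuous_subspaceT.
  by rewrite g1 min_l ?max_r; lra.
pose r t := rho (clamp t) / rho' t.
have E t1 : 0 < r t1 /\ w = (r t1 * cos (g t1), r t1 * sin (g t1)).
  have [r0 e] := H _ (clamp_itv t1); have [r0' e'] := H' t1.
  split; first exact: divr_gt0.
  have e1 := congr1 fst e'; have e2 := congr1 snd e'.
  move: e1 e2; rewrite /= e /= !(addrC z.1) !(addrC z.2) !addrK.
  rewrite /r /g cosD sinD cosN sinN -!mulrA => e1 e2.
  (* Rotate both sides of [e1] and [e2] back by the angle [theta' t1]. *)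
  have cs := cos2Dsin2 (theta' t1).
  have rn : rho' t1 != 0 by rewrite gt_eqF.
  rewrite [LHS]surjective_pairing; congr pair; apply: (mulfI rn).
    transitivity (rho' t1 * w.1 * (cos (theta' t1) ^+ 2 + sin (theta' t1) ^+ 2)).
      by rewrite cs mulr1.
    transitivity (cos (theta' t1) * (rho (clamp t1) * cos (theta (clamp t1)))
      + sin (theta' t1) * (rho (clamp t1) * sin (theta (clamp t1)))); last by field.
    by rewrite e1 e2; ring.
  transitivity (rho' t1 * w.2 * (cos (theta' t1) ^+ 2 + sin (theta' t1) ^+ 2)).
    by rewrite cs mulr1.
  transitivity (cos (theta' t1) * (rho (clamp t1) * sin (theta (clamp t1)))
    - sin (theta' t1) * (rho (clamp t1) * cos (theta (clamp t1)))); last by field.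
  by rewrite e1 e2; ring.
have [ra wa] := E 0; have [rb wb] := E t.
rewrite wa in wb; move: wb; rewrite gt cosDpi sinDpi => -[e1 e2].
have nr : r 0 + r t != 0 by rewrite gt_eqF// addr_gt0.
have c0 : cos (g 0) = 0 by apply: (mulfI nr); rewrite mulrDl e1; ring.
have s0 : sin (g 0) = 0 by apply: (mulfI nr); rewrite mulrDl e2; ring.
have := cos2Dsin2 (g 0); rewrite c0 s0 expr0n /= addr0 => /esym/eqP.
by rewrite oner_eq0.
Qed.
End Turning.

(** * Edge paths in the realization *)

Section EdgePaths.
Context {R : realType} {Y : complex2}.
Implicit Types (v u : vert Y) (d : dart Y) (p : seq (dart Y)).

Lemma dart_pt_le0 d (s : R) : s <= 0 -> dart_pt d s = Vpt (src d).
Proof.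
move=> s0; rewrite /dart_pt s0; case: pselect => // h.
by have := h; rewrite ltNge s0.
Qed.

Lemma dart_pt_ge1 d (s : R) : 1 <= s -> dart_pt d s = Vpt (tgt d).
Proof.
move=> s1; rewrite /dart_pt; case: pselect => [h|_].
  by have := h; rewrite !ltNge s1 andbF.
by rewrite leNgt (lt_le_trans ltr01 s1).
Qed.

(** The recursion on the path replaces the index arithmetic of [walk_pt] and makes
    proofs by induction on the path possible. *)
Fixpoint unit_speed_walk v p (x : R) : realization R Y :=
  if p is d :: q then
    if x < 1 then dart_pt d x else unit_speed_walk (tgt d) q (x - 1)
  else Vpt v.

Lemma walk_ptE v p (t : R) :
  walk_pt v p t = unit_speed_walk v p ((size p)%:R * t).
Proof.
case: p => // d q; rewrite /walk_pt; move: ((size (d :: q))%:R * t) => x.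
rewrite [(size (d :: q)).-1]/=.
elim: q d v x => [|d' q IH] d v x.
  rewrite minn0 subr0 /=; case: ltP => // x1; exact: dart_pt_ge1.
transitivity (if x < 1 then dart_pt d x
  else unit_speed_walk (tgt d) (d' :: q) (x - 1)) => //; case: ltP => x1.
  have -> : Num.truncn x = 0%N by apply/eqP; rewrite -leqn0 truncn_le_nat.
  by rewrite min0n subr0.
have tx : Num.truncn x = (Num.truncn (x - 1)).+1.
  apply: truncn_def; rewrite -!natr1 -lerBrDr -ltrBlDr natr1.
  by rewrite truncn_itv// subr_ge0.
rewrite -(IH d' (tgt d)) tx /= minnSS /=.
rewrite -natr1 opprD addrA [x - _ - 1]addrAC; congr dart_pt.
by apply: set_nth_default; rewrite /= ltnS geq_minr.
Qed.

Lemma walk_pt_dart v p (t : R) : p != [::] ->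
  exists d s, d \in p /\ walk_pt v p t = dart_pt d s.
Proof.
case: p => // d q _; rewrite /walk_pt; set i := minn _ _.
exists (nth d (d :: q) i), ((size (d :: q))%:R * t - i%:R); split=> //.
by apply: mem_nth; rewrite /= ltnS geq_minr.
Qed.

Lemma unit_speed_walk0 {v p u} : walk v p u -> unit_speed_walk v p 0 = Vpt v.
Proof.
by case: p => //= d q /andP[/eqP <- _]; rewrite ltr01 dart_pt_le0.
Qed.

(** Only the edges matter for the openness of [U] here: this is what allows this
    lemma to be used for proving that a set [U] is open in the realization, where
    its preimages along the attaching paths of the 2-cells are at stake. *)
Lemma open_unit_speed_walk {v p u} (U : set (realization R Y)) :
  (forall d, open (dart_pt d @^-1` U)) -> walk v p u ->
  open (unit_speed_walk v p @^-1` U).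
Proof.
move=> oU; elim: p v => [|d q IH] v.
  move=> _; have [vU|vU] := pselect (U (Vpt v)).
    by rewrite (_ : _ @^-1` _ = setT); [exact: openT|apply/seteqP; split].
  by rewrite (_ : _ @^-1` _ = set0); [exact: open0|apply/seteqP; split].
move=> /andP[_ wq]; have {}wq : walk (tgt d) q u by []; have w0 := unit_speed_walk0 wq.
(* Two open conditions, before and after time 1, that agree at time 1. *)
set A := dart_pt d @^-1` U.
set B := (fun x : R => x - 1) @^-1` (unit_speed_walk (tgt d) q @^-1` U).
have oB : open B.
  move: (IH _ wq); apply: open_comp => x _.
  apply: cvgB; [exact: cvg_id|exact: cvg_cst].
have AB1 : A 1 <-> B 1 by rewrite /A /B /= subrr w0 dart_pt_ge1.
rewrite (_ : _ @^-1` _ =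
    (A `&` [set x | x < 1]) `|` (B `&` [set x | 1 < x]) `|` (A `&` B)).
  have oA : open A by exact: oU.
  apply: openU; last exact: openI.
  by apply: openU; apply: openI.
apply/seteqP; split=> x /=.
  case: ltP => x1 Ux; first by left; left.
  have [x1'|x1'] := ltP 1 x; first by left; right.
  have e : x = 1 by apply/eqP; rewrite eq_le x1 x1'.
  by right; subst x; split=> //; apply/AB1.
by case: ltP => x1 [[[]|[]]|[]] //; move=> _ h; move: (lt_trans h x1); rewrite ltxx.
Qed.

Lemma open_walk_pt {v p u} (U : set (realization R Y)) :
  (forall d, open (dart_pt d @^-1` U)) -> walk v p u ->
  open (walk_pt v p @^-1` U).
Proof.
move=> oU /(open_unit_speed_walk U oU); rewrite (funext (walk_ptE v p)).
by apply: open_comp => x _; apply: cvgM; [exact: cvg_cst|exact: cvg_id].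
Qed.

Lemma continuous_walk_pt {v p u} : walk v p u -> continuous (@walk_pt R Y v p).
Proof.
move=> wp; apply/continuousP => U [oU _]; exact: open_walk_pt U oU wp.
Qed.
End EdgePaths.

(** * The path metric *)

Section Dist.
Context {Y : complex2}.
Implicit Types (v u : vert Y) (d : dart Y).

Lemma walk_rcons {v p d} : walk v p (src d) -> walk v (rcons p d) (tgt d).
Proof.
rewrite /walk; elim: p v => [|e p IH] v /=; first by move=> /eqP ->; rewrite !eqxx.
by move=> /andP[-> /=]; exact: IH.
Qed.

Lemma dist_le {v u p} : walk v p u -> (dist v u <= size p)%N.
Proof.
move=> wp; rewrite /dist; case: pselect => // ex.
by case: ex_minnP => m _; apply; apply/asboolP; exists p.
Qed.

Lemma distxx v : dist v v = 0%N.
Proof.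
by apply/eqP; rewrite -leqn0; apply: (@dist_le _ _ [::]); rewrite /walk /=.
Qed.

(** The ends of an edge are either both joined to [v] or both not joined to [v]; in
    the latter case both distances take the default value 0. *)
Lemma dist_tgt v d : (dist v (tgt d) <= (dist v (src d)).+1)%N.
Proof.
rewrite [dist v (src d)]/dist; case: pselect => [ex|nex].
  case: ex_minnP => m /asboolP[p wp <-] _.
  by rewrite -(size_rcons p d); exact/dist_le/walk_rcons.
rewrite [dist v _]/dist; case: pselect => // ex; case: nex.
case: ex => _ /asboolP[p wp _]; exists (size (rcons p (flip d))); apply/asboolP.
exists (rcons p (flip d)) => //.
by have := walk_rcons wp; rewrite /tgt flipK.
Qed.
End Dist.

(** * Coarse height associated with a vertex function *)

Section Height.
Context {R : realType} {Y : complex2}.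
Context (D : vert Y -> nat).
Implicit Types (d : dart Y).

Definition edge_height d : rat :=
  Num.min (D (src d))%:R (D (tgt d))%:R + 2^-1.

(** The coarse distance with the distance to the base point replaced by an arbitrary
    vertex function: the pullback along a cellular map of the coarse distance of
    the target is of this form too, so that the intrinsic and the extrinsic cases
    become instances of one statement on the diagram. *)
Definition height (p : realization R Y) : rat :=
  match p with
  | Vpt v => (D v)%:R
  | Ept d _ _ _ => edge_height d
  | Fpt f _ _ => \big[Num.max/0]_(d <- bd f) edge_height d - 4^-1
  end.

Lemma edge_heightE d : edge_height d = (minn (D (src d)) (D (tgt d)))%:R + 2^-1.
Proof. by rewrite /edge_height -natr_min. Qed.

Lemma edge_height_flip d : edge_height (flip d) = edge_height d.
Proof. by rewrite !edge_heightE /tgt flipK minnC. Qed.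

Lemma height_open_edge d (s : R) : 0 < s < 1 ->
  height (dart_pt d s) = edge_height d.
Proof.
move=> hs; rewrite /dart_pt; case: pselect => // hs'.
by rewrite /open_dart_pt; case: pselect => hd //=; exact: edge_height_flip.
Qed.

Context (D_tgt : forall d, (D (tgt d) <= (D (src d)).+1)%N).

Lemma D_src d : (D (src d) <= (D (tgt d)).+1)%N.
Proof. by have := D_tgt (flip d); rewrite /tgt flipK. Qed.

Lemma lt_edge_height (k : nat) d :
  (k%:R < edge_height d) = (k <= minn (D (src d)) (D (tgt d)))%N.
Proof.
rewrite edge_heightE; apply/idP/idP; last by rewrite -(ler_nat rat); lra.
by apply: contraTT; rewrite -ltnNge -leNgt -(ler_nat rat) -natr1; lra.
Qed.

(** If an end of an edge lies above [k] then, its neighbour being at most one lower,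
    both ends are at least [k] and the open edge lies above [k] as well. *)
Lemma height_dart_gt_ends {k : nat} {d} {s : R} :
  k%:R < height (dart_pt d s) -> (k <= minn (D (src d)) (D (tgt d)))%N.
Proof.
have := D_tgt d; have := D_src d; have [s0|s0] := leP s 0.
  by rewrite dart_pt_le0//= ltr_nat; lia.
have [s1|s1] := leP 1 s; first by rewrite dart_pt_ge1//= ltr_nat; lia.
by rewrite height_open_edge ?s0// lt_edge_height.
Qed.

Lemma open_dart_height_gt (k : nat) d :
  open (dart_pt d @^-1` [set p | k%:R < height p]).
Proof.
have [kD|kD] := leqP k (minn (D (src d)) (D (tgt d))); last first.
  rewrite (_ : _ @^-1` _ = set0); first exact: open0.
  by apply/seteqP; split=> // s /= /height_dart_gt_ends; rewrite leqNgt kD.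
pose left_part := [set s : R | 0 < s \/ (k < D (src d))%N].
pose right_part := [set s : R | s < 1 \/ (k < D (tgt d))%N].
have oL : open left_part.
  have [h|h] := boolP (k < D (src d))%N.
    rewrite (_ : left_part = setT); first exact: openT.
    by apply/seteqP; split=> // s _; right.
  rewrite (_ : left_part = [set s | 0 < s]); first exact: open_gt.
  by apply/seteqP; split=> s /=; [case=> //; rewrite (negbTE h)|left].
have oR : open right_part.
  have [h|h] := boolP (k < D (tgt d))%N.
    rewrite (_ : right_part = setT); first exact: openT.
    by apply/seteqP; split=> // s _; right.
  rewrite (_ : right_part = [set s | s < 1]); first exact: open_lt.
  by apply/seteqP; split=> s /=; [case=> //; rewrite (negbTE h)|left].
rewrite (_ : _ @^-1` _ = left_part `&` right_part); first exact: openI.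
apply/seteqP; split=> s /=; have [s0|s0] := leP s 0.
- rewrite dart_pt_le0//= ltr_nat; split; first by right.
  by left; rewrite (le_lt_trans s0).
- have [s1|s1] := leP 1 s.
    by rewrite dart_pt_ge1//= ltr_nat; split; [left|right].
  by split; left.
- rewrite dart_pt_le0//= ltr_nat => -[[]//].
  by rewrite ltNge s0.
- have [s1|s1] := leP 1 s.
    by rewrite dart_pt_ge1//= ltr_nat => -[_ []//]; rewrite ltNge s1.
  by move=> _; rewrite height_open_edge ?s0// lt_edge_height.
Qed.

(** An edge above [k] has height at least [k + 1/2], so that a 2-cell having it on
    its boundary has height at least [k + 1/4]. *)
Lemma face_height_gt (k : nat) (f : face Y) d (s : R) (z : R * R)
    (hz : sqnorm z < 1) : d \in bd f ->
  k%:R < height (dart_pt d s) -> k%:R < height (Fpt f z hz).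
Proof.
move=> df ks; have kd := height_dart_gt_ends ks.
have : edge_height d <= \big[Num.max/0]_(e <- bd f) edge_height e.
  exact: le_bigmax_seq.
rewrite /= edge_heightE; move: kd; rewrite -(ler_nat rat).
set M := \big[_/_]_(_ <- _) _; lra.
Qed.

(** The cells of height at most [k] form a subcomplex: by the two lemmas above, a
    cell whose boundary meets the points above [k] lies itself above [k]. *)
Lemma open_height_gt (k : nat) : open [set p | k%:R < height p].
Proof.
have oD d := open_dart_height_gt k d; split=> // f.
set U := [set p | _].
have oW : open
    ((fun rt : R * R => walk_pt (corner f) (bd f) (clamp rt.2)) @^-1` U).
  have wf : walk (corner f) (bd f) (corner f) := bd_closed f.
  have := open_walk_pt U oD wf; apply: open_comp => rt _.
  apply: (@continuous_comp _ _ _ snd (@clamp R)); first exact: cvg_snd.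
  exact: continuous_clamp.
(* The height is constant on the open 2-cell: it lies in [U] or misses [U], and in
   the latter case so does its boundary. *)
have [fU|fU] := pselect (exists z (hz : sqnorm z < 1), U (Fpt f z hz)).
  have {}fU z hz : U (Fpt f z hz) by case: fU => z' [hz'].
  rewrite (_ : _ @^-1` _ = [set rt : R * R | clamp rt.1 < 1] `|`
    (fun rt : R * R => walk_pt (corner f) (bd f) (clamp rt.2)) @^-1` U).
    apply: openU => //; apply: (@open_comp _ _ (fun rt : R * R => clamp rt.1)
      [set x | x < 1]); last exact: open_lt.
    move=> rt _; apply: (@continuous_comp _ _ _ fst (@clamp R)); first exact: cvg_fst.
    exact: continuous_clamp.
  apply/seteqP; split=> rt; rewrite /preimage /= /face_pt; case: pselect => h //.
  - by left.
  - by right.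
  - by case.
rewrite (_ : _ @^-1` _ = set0); first exact: open0.
apply/seteqP; split=> // rt; rewrite /preimage /= /face_pt; case: pselect => h Uf.
  by apply: fU; eexists; eexists; exact: Uf.
have [d [s [df E]]] := walk_pt_dart (corner f) (bd f) (clamp rt.2) (bd_nnil f).
have z0 : sqnorm (0 : R * R) < 1 by rewrite /sqnorm /= expr0n addr0 ltr01.
apply: fU; exists 0, z0; apply: (face_height_gt k f d s 0 z0 df).
by move: Uf; rewrite /U /= E.
Qed.

(** An open edge has height half above its lower end, hence at most half above its
    source, which is reached before the path is exhausted. *)
Lemma height_walk_le v p u (x : R) : walk v p u ->
  height (unit_speed_walk v p x) <= (D v + size p)%:R.
Proof.
elim: p v x => [|d q IH] v x; first by rewrite addn0.
move=> /andP[/eqP vE wq]; have {}wq : walk (tgt d) q u by [].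
have Dd := D_tgt d; rewrite -vE /=; case: ltP => x1; last first.
  by apply: (le_trans (IH _ _ wq)); rewrite ler_nat; lia.
have [x0|x0] := leP x 0; first by rewrite dart_pt_le0//= ler_nat leq_addr.
rewrite height_open_edge ?x0// edge_heightE natrD -[(size q).+1%:R]natr1.
have : (minn (D (src d)) (D (tgt d)))%:R <= (D (src d))%:R :> rat.
  by rewrite ler_nat geq_minl.
have : 0 <= (size q)%:R :> rat by rewrite ler0n.
lra.
Qed.

Lemma height_skel1_quarter (p : realization R Y) :
  skel1 p -> height p \in quarter.
Proof.
case: p => [v|d s hd hs|] //= _; rewrite inE.
  by rewrite -natrM; exact: natr_nat.
rewrite edge_heightE mulrDl (_ : 2^-1 * 4 = 2%:R :> rat); last by lra.
by rewrite -natrM -natrD; exact: natr_nat.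
Qed.

Lemma skel1_walk_pt v p (t : R) : @skel1 R Y (walk_pt v p t).
Proof.
have [->|p0] := eqVneq p [::]; first by [].
have [d [s [_ ->]]] := walk_pt_dart v p t p0; rewrite /dart_pt.
case: pselect => hs; last by case: ifP.
by rewrite /open_dart_pt; case: pselect.
Qed.
End Height.

(** * Combings of van Kampen diagrams are onto *)

Lemma sqnorm_polar {R : realType} (r t : R) : sqnorm (polar r t) = r ^+ 2.
Proof. by rewrite /sqnorm /polar /= !exprMn -mulrDr cos2Dsin2 mulr1. Qed.

Lemma polar01 {R : realType} (r : R) : polar r 0 = polar r 1.
Proof. by rewrite /polar mulr0 mulr1 cos0 sin0 mulr_natl cos2pi sin2pi. Qed.

Lemma continuous_polar {R : realType} {T : topologicalType} {r t : T -> R} :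
  continuous r -> continuous t -> continuous (fun x => polar (r x) (t x)).
Proof.
move=> cr ct.
have ca : continuous (fun x => 2 * pi * t x).
  by move=> x; apply: cvgM; [exact: cvg_cst|exact: ct].
apply: continuous_pair => x; apply: cvgM.
- exact: cr.
- have E := @continuous_cos R (2 * pi * t x). exact: (cvg_comp _ _ (ca x) E).
- exact: cr.
- have E := @continuous_sin R (2 * pi * t x). exact: (cvg_comp _ _ (ca x) E).
Qed.

Section Surjectivity.
Context {R : realType} {G : groupType} {P : presentation G} {w : seq (letter P)}.
Context {Delta : vk_diagram R w}.
Context {Psi : realization R Delta * R -> realization R Delta}.
Context (Psi_combing :
  combing1 (boundary (@emb _ _ _ _ Delta)) (Vpt (base Delta)) Psi).

Local Notation emb := (@emb _ _ _ _ Delta).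
Local Notation bdry := (boundary emb).

Let loop (t : R) : realization R Delta :=
  walk_pt (base Delta) (circuit Delta) (clamp t).

Lemma boundary_loop t : bdry (loop t).
Proof.
by have [_ <- _] := vk_circuit Delta; exists (clamp t); rewrite //= in_itv/= clamp_itv.
Qed.

Lemma continuous_loop : continuous loop.
Proof.
move=> t; apply: continuous_comp; first exact: continuous_clamp.
by have [cw _ _] := vk_circuit Delta; exact: (continuous_walk_pt cw).
Qed.

Lemma continuous_clamp_comp {T : topologicalType} {g : T -> R} :
  continuous g -> continuous (fun x => clamp (g x)).
Proof.
by move=> cg x; apply: (@continuous_comp _ _ _ g); [exact: cg|exact: continuous_clamp].
Qed.

Lemma continuous_plane_sub {T : topologicalType}
    {c q : T -> R * R} :
  continuous c -> continuous q -> continuous (fun x => c x - q x).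
Proof. by move=> cc cq x; apply: cvgB; [exact: cc|exact: cq]. Qed.

(** If [q] is missed by the combing, then the boundary loop is contracted to the base
    point by the combing without meeting [q]. Outside the diagram, the boundary
    loop is also deformed into the image of the circle of radius 2 by the
    parametrization of the complementary cell. This last loop misses the whole
    diagram, so that [q] may be moved to the base point inside the contractible
    diagram without changing the winding number. It turns once around the base
    point, whereas a constant loop does not turn. *)
Lemma combing_surjective (q : realization R Delta) :
  exists p (t : R), [/\ bdry p, 0 <= t <= 1 & Psi (p, t) = q].
Proof.
apply: contrapT => nq.
have Psi_neq p (t : R) : bdry p -> 0 <= t <= 1 -> Psi (p, t) <> q.
  by move=> bp t01 E; apply: nq; exists p, t.
have [_ _ [Phi [cPhi [_ [_ [_ Phi_out _ _ _]]] Phi1 Phi2]]] :=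
  vk_circuit Delta.
have [ccont cstart cend _ _] := Psi_combing.
have cemb := @vk_emb_cont _ _ _ _ Delta; have iemb := @vk_emb_inj _ _ _ _ Delta.
have cfst : continuous (@fst R R) by move=> ?; exact: cvg_fst.
have csnd : continuous (@snd R R) by move=> ?; exact: cvg_snd.
have ccst (z : R * R) : continuous (fun _ : R * R => z).
  by move=> ?; exact: cvg_cst.
have sub_neq0 (z : R * R) p : z <> emb p -> z - emb p != 0.
  by move=> zp; rewrite subr_eq0; apply/eqP.
have Phi_loop t : Phi (polar 1 (clamp t)) = emb (loop t) by rewrite Phi1 ?clamp_itv.
have Phi_range r t p : 1 < r -> Phi (polar r t) <> emb p.
  move=> r1 E; have : (~` range emb) (Phi (polar r t)).
    by apply: Phi_out; rewrite /= sqnorm_polar exprn_egt1.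
  by apply; exists p.
have loop01 : loop 0 = loop 1.
  by apply: iemb; rewrite -!Phi_loop clamp0 clamp1 polar01.
(* The combing contracts the boundary loop. *)
pose H1 (ts : R * R) : R * R := emb (Psi (loop ts.1, clamp ts.2)) - emb q.
have cH1 : continuous H1.
  apply: continuous_plane_sub => // x.
  apply: (@continuous_comp _ _ _ (fun ts : R * R => Psi (loop ts.1, clamp ts.2)) emb);
    last exact: cemb.
  apply: (within_comp_continuous ccont) => [|y].
    apply: continuous_pair; last exact: continuous_clamp_comp.
    move=> y; apply: (@continuous_comp _ _ _ fst loop); first exact: cfst.
    exact: continuous_loop.
  by split=> /=; [exact: boundary_loop|rewrite in_itv/= clamp_itv].
have S1 := homotopy_same_turns cH1 _ _ 0 1.
have {}S1 : same_turns (cst (emb (Vpt (base Delta)) - emb q))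
    (fun t => emb (loop t) - emb q).
  have e1 : (fun t => H1 (clamp t, 0)) = cst (emb (Vpt (base Delta)) - emb q).
    by apply/funext => t; rewrite /H1 /= clamp0 cstart//; exact: boundary_loop.
  have e2 : (fun t => H1 (clamp t, 1)) = (fun t => emb (loop t) - emb q).
    apply/funext => t; rewrite /H1 /= clamp1 cend; first by rewrite /loop clampK.
    exact: boundary_loop.
  rewrite -e1 -e2; apply: S1 => [ts|s]; last by rewrite /H1 /= loop01.
  apply: sub_neq0 => /iemb; apply: Psi_neq; first exact: boundary_loop.
  exact: clamp_itv.
(* The exterior cell pushes the boundary loop to the circle of radius 2. *)
pose H2 (ts : R * R) : R * R := Phi (polar (1 + clamp ts.2) (clamp ts.1)) - emb q.
have cH2 : continuous H2.
  apply: continuous_plane_sub => //.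
  apply: (within_comp_continuous cPhi) => [|y].
    apply: continuous_polar; last exact: continuous_clamp_comp.
    move=> x; apply: cvgD; first exact: cvg_cst.
    exact: (continuous_clamp_comp csnd).
  rewrite /= sqnorm_polar exprn_ege1// lerDl.
  by case/andP: (clamp_itv y.2).
have S2 := homotopy_same_turns cH2 _ _ 0 1.
have {}S2 : same_turns (fun t => emb (loop t) - emb q)
    (fun t => Phi (polar 2 (clamp t)) - emb q).
  have e1 : (fun t => H2 (clamp t, 0)) = (fun t => emb (loop t) - emb q).
    by apply/funext => t; rewrite /H2 /= clamp0 addr0 clampK Phi_loop.
  have e2 : (fun t => H2 (clamp t, 1)) =
      (fun t => Phi (polar 2 (clamp t)) - emb q).
    by apply/funext => t; rewrite /H2 /= clamp1 clampK.
  rewrite -e1 -e2; apply: S2 => [[t s]|s]; last first.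
    by rewrite /H2 /= clamp0 clamp1 polar01.
  apply: sub_neq0 => /=; have [s0|s0] := leP (clamp s) 0.
    have -> : clamp s = 0 by apply/eqP; rewrite eq_le s0; case/andP: (clamp_itv s).
    rewrite addr0 Phi_loop => /iemb E; apply: (Psi_neq (loop t) 1).
    + exact: boundary_loop.
    + by rewrite ler01 lexx.
    + by rewrite cend//; exact: boundary_loop.
  by apply: Phi_range; rewrite ltrDl.
(* Contract the diagram, moving the centre [p] to [x0] under the fixed loop; this
   is applied to [q] and to the base point. *)
have [x0 [K [cK Kends]]] := @vk_contractible _ _ _ _ Delta.
have S3 p : same_turns (fun t => Phi (polar 2 (clamp t)) - emb p)
    (fun t => Phi (polar 2 (clamp t)) - emb x0).
  pose H3 (ts : R * R) : R * R := Phi (polar 2 (clamp ts.1)) - emb (K (p, clamp ts.2)).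
  have cH3 : continuous H3.
    apply: continuous_plane_sub => x.
      apply: (@within_comp_continuous _ _ _ _ Phi
        (fun ts : R * R => polar 2 (clamp ts.1)) cPhi) => [|y].
        apply: continuous_polar; last exact: continuous_clamp_comp.
        by move=> ?; exact: cvg_cst.
      by rewrite /= sqnorm_polar exprn_ege1// ler1n.
    apply: (@continuous_comp _ _ _ (fun ts : R * R => K (p, clamp ts.2)) emb);
      last exact: cemb.
    apply: (within_comp_continuous cK) => [|y].
      apply: continuous_pair; last exact: continuous_clamp_comp.
      by move=> ?; exact: cvg_cst.
    by split=> //=; rewrite in_itv/= clamp_itv.
  have S3 := homotopy_same_turns cH3 _ _ 0 1.
  have e1 : (fun t => H3 (clamp t, 0)) = (fun t => Phi (polar 2 (clamp t)) - emb p).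
    by apply/funext => t; rewrite /H3 /= clamp0 clampK (Kends _).1.
  have e2 : (fun t => H3 (clamp t, 1)) = (fun t => Phi (polar 2 (clamp t)) - emb x0).
    by apply/funext => t; rewrite /H3 /= clamp1 clampK (Kends _).2.
  rewrite -e1 -e2; apply: S3 => [ts|s]; last by rewrite /H3 /= clamp0 clamp1 polar01.
  by apply: sub_neq0; apply: Phi_range; rewrite ltr1n.
have S := same_turns_trans (same_turns_trans S1 S2)
  (same_turns_trans (S3 q) (same_turns_sym (S3 (Vpt (base Delta))))).
apply: (turns_once_not_cst Phi2 _ S); apply: sub_neq0 => /iemb E.
apply: (Psi_neq (loop 0) 0); first exact: boundary_loop.
  by rewrite lexx ler01.
by rewrite cstart//; exact: boundary_loop.
Qed.
End Surjectivity.

(** * Tame combings bound heights of vertices *)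

Section TameBound.
Context {R : realType} {G : groupType} {P : presentation G} {w : seq (letter P)}.
Context {Delta : vk_diagram R w}.

(** A vertex [v] is reached by the combing path of some boundary point [p]. If this
    happens before time 1 then [D v] is at most [f] of the height of [p], which is
    at most the length of the boundary. If [v] is itself the boundary point, then
    just before time 1 its combing path lies in the open set of points of height
    greater than [D v - 1], so that [f] of the height of [v] exceeds [D v - 1];
    rounding up does the rest. *)
Lemma tame_height_bound (Psi : realization R Delta * R -> realization R Delta)
    (D : vert Delta -> nat) (f : rat -> rat) :
  combing1 (boundary (@emb _ _ _ _ Delta)) (Vpt (base Delta)) Psi ->
  (forall d, (D (tgt d) <= (D (src d)).+1)%N) -> D (base Delta) = 0%N ->
  {in quarter &, {homo f : x y / x <= y}} ->
  (forall p, boundary (@emb _ _ _ _ Delta) p ->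
    forall s t : R, 0 <= s -> s < t -> t <= 1 ->
    height D (Psi (p, s)) <= f (height D (Psi (p, t)))) ->
  forall v, (D v <= hat f (size w))%N.
Proof.
move=> Psi_combing D_tgt D0 f_mono Psi_tame v.
have [ccont _ cend _ _] := Psi_combing.
have f_le p : boundary (@emb _ _ _ _ Delta) p ->
    f (height D p) <= f (size w)%:R.
  have [cw <- _] := vk_circuit Delta.
  move=> [t _ <-]; apply: f_mono.
  - by apply: height_skel1_quarter; exact: skel1_walk_pt.
  - by rewrite inE -natrM natr_nat.
  - rewrite walk_ptE -[in X in _ <= X](vk_lab_circuit Delta) size_map.
    have := height_walk_le D D_tgt _ _ _ ((size (circuit Delta))%:R * t) cw.
    by rewrite D0.
case Dv : (D v) => [//|k].
suff : k%:R < f (size w)%:R.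
  rewrite /hat -[k%:R]/(k%:Z%:~R) -ceil_gt_int; by case: (Num.ceil _) => c; lia.
have [p [t [bp /andP[t0 t1] E]]] := combing_surjective Psi_combing (Vpt v).
have [t_lt1|t_ge1] := ltP t 1.
  apply: lt_le_trans (f_le p bp).
  have := Psi_tame p bp t 1 t0 t_lt1 (lexx 1); rewrite E cend//= Dv.
  by apply: lt_le_trans; rewrite ltr_nat.
have bv : boundary (@emb _ _ _ _ Delta) (Vpt v).
  by rewrite -E (_ : t = 1) ?cend//; apply/eqP; rewrite eq_le t1.
apply: lt_le_trans (f_le _ bv).
have cpath : continuous (fun s : R => Psi (Vpt v, clamp s)).
  apply: (within_comp_continuous ccont) => [|s].
    by apply: continuous_pair; [move=> ?; exact: cvg_cst|exact: continuous_clamp].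
  by split=> //=; rewrite in_itv/= clamp_itv.
have Uv : nbhs (Psi (Vpt v, clamp 1)) [set p | k%:R < height D p].
  apply: open_nbhs_nbhs; split; first exact: open_height_gt.
  by rewrite /= clamp1 cend//= Dv ltr_nat.
have /nbhs_ballP[e /= e0 eU] := cpath 1 _ Uv.
pose s : R := Num.max 0 (1 - e / 2).
have s0 : 0 <= s by rewrite le_max lexx.
have s1 : s < 1 by rewrite gt_max ltr01/= ltrBlDr ltrDl divr_gt0.
have : k%:R < height D (Psi (Vpt v, clamp s)).
  apply: eU; rewrite /ball/= ger0_norm ?subr_ge0 ?(ltW s1)//.
  have : 1 - e / 2 <= s by rewrite le_max lexx orbT.
  lra.
rewrite clamp_id ?s0 ?ltW// => h; apply: (lt_le_trans h).
by have := Psi_tame _ bv s 1 s0 s1 (lexx 1); rewrite cend.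
Qed.
End TameBound.

(** * Diameter filling functions *)

(** The pointwise minimum of all nondecreasing functions satisfying [Q] works: the
    first hypothesis says that [Q] is a condition on the values one at a time. *)
Lemma least_nondecreasing_exists (Q : (nat -> nat) -> Prop) (h0 : nat -> nat) :
  (forall h, (forall n, exists h', [/\ {homo h' : m n / (m <= n)%N}, Q h'
     & h' n = h n]) -> Q h) ->
  {homo h0 : m n / (m <= n)%N} -> Q h0 ->
  exists h, least_nondecreasing Q h /\ forall n, (h n <= h0 n)%N.
Proof.
move=> Qloc h0_mono Qh0.
pose val n m := exists h', [/\ {homo h' : m n / (m <= n)%N}, Q h' & h' n = m].
have ex n : exists m, `[< val n m >] by exists (h0 n); apply/asboolP; exists h0.
pose h n := ex_minn (ex n).
have hP n : val n (h n) by rewrite /h; case: ex_minnP => m /asboolP.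
have h_le h' n : {homo h' : m n / (m <= n)%N} -> Q h' -> (h n <= h' n)%N.
  move=> h'_mono Qh'; rewrite /h; case: ex_minnP => m _; apply.
  by apply/asboolP; exists h'.
exists h; split; last by move=> n; exact: h_le.
split; last by move=> h' *; exact: h_le.
  move=> m n mn; have [h' [h'_mono Qh' <-]] := hP n.
  by apply: leq_trans (h'_mono _ _ mn); exact: h_le.
by apply: Qloc => n; have [h' [h'_mono Qh' E]] := hP n; exists h'.
Qed.

Lemma hat_nondecreasing (f : rat -> rat) :
  (forall x, x \in quarter -> f x \in quarter) ->
  {in quarter &, {homo f : x y / x <= y}} ->
  {homo hat f : m n / (m <= n)%N}.
Proof.
move=> fq f_mono m n mn.
have nq (k : nat) : k%:R \in quarter by rewrite inE -natrM natr_nat.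
have f0 k : 0 <= f k%:R.
  by have := fq _ (nq k); rewrite inE => /natr_ge0; rewrite pmulr_lge0.
have c0 k : (0 <= Num.ceil (f k%:R))%R by rewrite ceil_ge0 (lt_le_trans _ (f0 k)).
have : (Num.ceil (f m%:R) <= Num.ceil (f n%:R))%R.
  by apply: le_ceil; apply: f_mono; rewrite ?nq ?ler_nat.
by rewrite /hat; have := c0 m; have := c0 n; lia.
Qed.

Lemma coarse_dist_height {R : realType} {Y : complex2} (y : vert Y) p :
  @coarse_dist R Y y p = height (dist y) p.
Proof. by case: p. Qed.

(** A cellular map sends the open cells of an edge or 2-cell onto those of its
    image, up to reversal of the edge, which does not affect the height. *)
Lemma coarse_dist_realize {R : realType} {Y Y' : complex2} (phi : cmap Y Y')
    (y' : vert Y') (p : realization R Y) :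
  coarse_dist y' (realize phi p) = height (fun v => dist y' (on_vert phi v)) p.
Proof.
have E d : edge_height (fun v => dist y' (on_vert phi v)) d =
    edge_height (dist y') (on_dart phi d).
  by rewrite !edge_heightE /tgt !cmap_src -cmap_flip cmap_src.
rewrite coarse_dist_height; case: p => [//|d s hd hs|g z hz] /=.
  by rewrite height_open_edge.
by rewrite cmap_bd big_map; congr (_ - _); apply: eq_bigr => d _; rewrite E.
Qed.

Theorem proposition3p2 (R : realType) (G : groupType) (P : presentation G)
    (f : rat -> rat)
    (f_quarter : forall x, x \in quarter -> f x \in quarter)
    (f_nondecreasing : {in quarter &, {homo f : x y / x <= y}}) :
  (intrinsic_tame_filling R P f ->
     exists h : nat -> nat, intrinsic_diam_filling R P h /\
       forall n : nat, (h n <= hat f n)%N) /\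
  (extrinsic_tame_filling R P f ->
     exists h : nat -> nat, extrinsic_diam_filling R P h /\
       forall n : nat, (h n <= hat f n)%N).
Proof.
have hat_mono := hat_nondecreasing f f_quarter f_nondecreasing.
split=> tame_f; apply: least_nondecreasing_exists => //.
- move=> h hloc w w1; have [h' [_ Qh' <-]] := hloc (size w); exact: Qh' w1.
(* [height (dist y)] and [coarse_dist y] are convertible. *)
- move=> w w1; have [Delta [Psi [Psi_combing Psi_tame]]] := tame_f w w1.
  exists Delta; apply: (tame_height_bound Psi) => //.
  + exact: dist_tgt.
  + exact: distxx.
- move=> h hloc w w1; have [h' [_ Qh' <-]] := hloc (size w); exact: Qh' w1.
- move=> w w1; have [Delta [phi [Psi [phi_proj Psi_combing Psi_tame]]]] := tame_f w w1.
  exists Delta, phi; split=> //.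
  apply: (tame_height_bound Psi
    (fun v => dist (1%g : vert (cayley P)) (on_vert phi v))) => //.
  + move=> d; rewrite /tgt -!cmap_src cmap_flip; exact: dist_tgt.
  + by rewrite phi_proj.1 distxx.
  + by move=> p bp s t s0 st t1; rewrite -!coarse_dist_realize; exact: Psi_tame.
Qed.
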